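(* Let $n,d\ge 1$ be integers and let $\mu_1,\dots,\mu_n$ be Borel probability measures on $\mathbb{R}^d$. For a set $S\subset [n]:=\{1,2,\dots,n\}$, let $\mu_S$ denote the convolution of the measures $(\mu_i)_{i\in S}$, that is, the law of $\sum_{i\in S}X_i$ where $X_i\sim\mu_i$ are independent. Let $\mathcal{C}$ be a collection of distinct subsets of $[n]$, put $$t:=\min_{i\in[n]}\#\{S\in\mathcal{C}: i\in S\},$$ and assume $t\ge 1$. Then $$C_p(\mu_{[n]})\le \frac{1}{t}\sum_{S\in\mathcal{C}}C_p(\mu_S).$$
   Context: A Borel probability measure $\mu$ on $\mathbb{R}^d$ satisfies a Poincaré inequality with constant $C\ge 0$ if $\operatorname{Var}_\mu(f)\le C\int_{\mathbb{R}^d}|\nabla f|^2\,d\mu$ for all locally Lipschitz functions $f:\mathbb{R}^d\to\mathbb{R}$, where $\nabla$ is the usual gradient and $|\cdot|$ the Euclidean norm (at points $x$ where $f$ is not differentiable, $|\nabla f|(x):=\limsup_{y\to x}|f(x)-f(y)|/|x-y|$). The Poincaré constant $C_p(\mu)\in[0,\infty]$ is the smallest constant $C$ for which this holds, with $C_p(\mu)=\infty$ if there is none. The empty sum is $0$, so $\mu_\emptyset=\delta_0$. *)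

(* Defs.v *)
From HB Require Import structures.
From mathcomp Require Import all_boot all_order all_algebra.
From mathcomp Require Import all_classical all_reals all_analysis.
From mathcomp Require Import measurable_realfun.

Set Implicit Arguments.
Unset Strict Implicit.
Unset Printing Implicit Defensive.

Import Order.TTheory GRing.Theory Num.Theory.
Import numFieldNormedType.Exports.

Local Open Scope classical_set_scope.
Local Open Scope ring_scope.

Definition borelRd (R : realType) (d : nat) :=
  g_sigma_algebraType [set U : set 'rV[R]_d | open U].

(* `|x| on 'rV[R]_d is the sup norm. The topology and differentiability, which
   do not depend on the choice of a norm, are those of the library. *)
Definition enorm (R : realType) (d : nat) (x : 'rV[R]_d) : R :=
  Num.sqrt (\sum_(j < d) x ord0 j ^+ 2).

Definition locally_lipschitz (R : realType) (d : nat) (f : 'rV[R]_d -> R) :=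
  forall x : 'rV[R]_d, exists L : R,
    \forall y \near x & z \near x, `|f y - f z| <= L * enorm (y - z).

Definition gradient (R : realType) (d : nat) (f : 'rV[R]_d -> R)
    (x : 'rV[R]_d) : 'rV[R]_d :=
  \row_(j < d) 'D_(delta_mx ord0 j) f x.

Definition norm_gradient (R : realType) (d : nat) (f : 'rV[R]_d -> R)
    (x : 'rV[R]_d) : \bar R :=
  if `[< differentiable f x >] then (enorm (gradient f x))%:E
  else limf_esup (fun y => (`|f x - f y| / enorm (x - y))%:E) x^'.

(* 'V_mu[f] is +oo when f is not square integrable. *)
Definition poincare (R : realType) (d : nat)
    (mu : probability (borelRd R d) R) (C : R) :=
  forall f : 'rV[R]_d -> R, locally_lipschitz f ->
    ('V_mu[f] <= C%:E * \int[mu]_x (norm_gradient f x ^+ 2))%E.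

Definition poincare_constant (R : realType) (d : nat)
    (mu : probability (borelRd R d) R) : \bar R :=
  ereal_inf [set C%:E | C in [set C : R | 0 <= C /\ poincare mu C]].

Section measurable_addition.
Context {R : realType} {n : nat}.

Lemma measurable_coord (j : 'I_n) :
  measurable_fun [set: borelRd R n] (fun x : borelRd R n => (x : 'rV[R]_n) ord0 j).
Proof.
apply: (measurability _ (RGenOInfty.measurableE R)) => _ [_ [a ->] <-].
rewrite setTI; apply: sub_sigma_algebra => /=.
apply: (@open_comp _ _ (fun x : 'rV[R]_n => x ord0 j)); last exact: interval_open.
by move=> x _; exact: coord_continuous.
Qed.

Definition rat_ball (p : 'rV[rat]_n * rat) : set 'rV[R]_n :=
  ball (map_mx ratr p.1 : 'rV[R]_n) (ratr p.2).

Lemma open_bigcup_rat_ball (U : set 'rV[R]_n) : open U ->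
  U = \bigcup_(p in [set p | rat_ball p `<=` U]) rat_ball p.
Proof.
move=> oU; apply/seteqP; split=> [x Ux|x [p pU]]; last exact: pU.
have /nbhs_ballP[e /= e0 xU] : nbhs x U by exact: open_nbhs_nbhs.
have [r /itvP re] := @rat_in_itvoo R 0 (e / 2) (divr_gt0 e0 (ltr0n _ 2)).
have r0 : 0 < (ratr r : R) by rewrite re.
have /choice[q hq] : forall j : 'I_n, exists q : rat,
    ball (ratr q : R) (ratr r) (x ord0 j).
  move=> j.
  have [q /itvP hq] := @rat_in_itvoo R (x ord0 j) (x ord0 j + ratr r)
    (ltr_pwDr r0 (lexx _)).
  exists q; rewrite /ball/= ltr_norml ltrBlDl hq andbT.
  by rewrite (lt_trans (_ : - ratr r < 0)) ?oppr_lt0// subr_gt0 hq.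
have xq : rat_ball (\row_j q j, r) x.
  by split=> // i j; rewrite !mxE ord1; exact: hq.
exists (\row_j q j, r) => //= y qy; apply: xU.
apply: (@le_ball _ _ _ (ratr r + ratr r)).
  by rewrite [leRHS]splitr lerD// ltW// re.
by apply: ball_triangle (ball_sym xq) qy.
Qed.

Lemma measurable_fun_coordP d (T : measurableType d) (f : T -> borelRd R n) :
  (forall j, measurable_fun setT (fun x => (f x : 'rV[R]_n) ord0 j)) ->
  measurable_fun setT f.
Proof.
move=> mf; apply: (@measurability _ _ _ (borelRd R n) _ f [set U : set 'rV[R]_n | open U]) => // _ [U /open_bigcup_rat_ball -> <-].
rewrite setTI preimage_bigcup bigcup_mkcond.
apply: countable_bigcupT_measurable => [|p]; first exact: countableP.
case: ifPn => // _.
have [r0|r0] := ltP 0 (ratr p.2 : R); last first.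
  rewrite (_ : _ @^-1` _ = set0)//; apply/seteqP; split=> // x [].
  by rewrite ltNge r0.
rewrite (_ : _ @^-1` _ = \bigcap_(j in [set: 'I_n])
  ((fun x => (f x : 'rV[R]_n) ord0 j) @^-1` ball (ratr (p.1 ord0 j) : R) (ratr p.2))).
  apply: fin_bigcap_measurable => // j _.
  rewrite -[X in measurable X]setTI; apply: mf => //.
  by apply: open_measurable; exact: ball_open.
apply/seteqP; split=> x /=.
  by move=> [_ /(_ ord0)] + j _ => /(_ j); rewrite mxE.
by move=> h; split=> // i j; rewrite ord1 mxE; exact: h.
Qed.

Definition addRd (x : borelRd R n * borelRd R n) : borelRd R n :=
  (x.1 : 'rV[R]_n) + (x.2 : 'rV[R]_n).

Lemma measurable_addRd : measurable_fun setT addRd.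
Proof.
apply: measurable_fun_coordP => j.
rewrite (_ : (fun _ => _) = (fun x => (x.1 : 'rV[R]_n) ord0 j)
    \+ (fun x => (x.2 : 'rV[R]_n) ord0 j)); last first.
  by apply/funext => x /=; rewrite /addRd mxE.
apply: measurable_funD.
- exact: (measurableT_comp (measurable_coord j) measurable_fst).
- exact: (measurableT_comp (measurable_coord j) measurable_snd).
Qed.

HB.instance Definition _ :=
  isMeasurableFun.Build _ _ _ _ addRd measurable_addRd.

End measurable_addition.

(* The law of X + Y for independent X and Y of laws mu and nu. *)
Definition convolution (R : realType) (d : nat)
    (mu nu : probability (borelRd R d) R) : probability (borelRd R d) R :=
  distribution (mu \x nu)%E addRd.

Definition delta0 (R : realType) (d : nat) : probability (borelRd R d) R :=
  @dirac _ (borelRd R d) (0 : 'rV[R]_d) R.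

Definition convolution_set (R : realType) (n d : nat)
    (mu : 'I_n -> probability (borelRd R d) R) (S : {set 'I_n}) :
    probability (borelRd R d) R :=
  \big[@convolution R d / delta0 R d]_(i in S) mu i.

(* #|C| is a bound for the terms, so this is their minimum when 0 < n. *)
Definition min_degree (n : nat) (C : {set {set 'I_n}}) : nat :=
  \big[minn/#|C|]_(i < n) #|[set S in C | i \in S]%SET|.

(* Main.v *)
Require Import Defs.
From mathcomp Require Import all_boot all_order all_algebra.
From mathcomp Require Import all_classical all_reals all_analysis.
From mathcomp Require Import measurable_realfun ring lra.

(** Write law S for mu_S and T for the whole index set. For a bounded f, put

      energy f S = E_{x ~ law S} [ (E_{y ~ law (~: S)} f (x + y))^2 ],

    the second moment of the conditional expectation of f (sum of the X_i)
    given (X_i), i in S. Two identities drive the proof: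
      - energy f T - energy f set0 is the variance of f under law T;
      - energy f T - energy f (~: S) is the mean, over x ~ law (~: S), of the
        variance of f (x + .) under law S ([integral_variance]).

    As a function of S the energy is nondecreasing (Jensen's inequality) and
    supermodular ([energy_supermodular]): averaging over a further independent
    variable can only decrease a variance ([variance_Rintegral_le]). Adding the
    indices one at a time, supermodularity bounds the gain from ~: S to T below
    by the sum over i in S of the gains D i obtained when i is added to its
    predecessors. Each i lies in at least t members of C and D i >= 0, hence
    ([supermodular_cover], a variance version of Shearer's lemma)

      t * (energy f T - energy f set0)
        <= sum_(S in C) (energy f T - energy f (~: S)).

    This bounds t times the variance of f by the sum of the mean conditional
    variances ([variance_cover]). The Poincare inequality for law S, applied to
    the translate f (x + .) and integrated over x ~ law (~: S), turns the term
    of S into (constant of S) * E |grad f|^2, and the theorem follows.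

    Two analytic points need care. Tonelli's theorem requires |grad f| to be
    Borel and compatible with translations; this is visible once it is known
    that the upper limit of the difference quotients equals the norm of the
    gradient at the points of differentiability too ([norm_gradientE]). And f
    may be unbounded, even not square integrable: the inequality is proved for
    the truncations of f, which contract distances and so have smaller slopes,
    and it passes to the limit since the variance is lower semicontinuous
    ([variance_lsc]). *)

Set Implicit Arguments.
Unset Strict Implicit.
Unset Printing Implicit Defensive.

Import Order.TTheory GRing.Theory Num.Theory.
Import numFieldNormedType.Exports.

(** * Variance without integrability assumptions *)

Section variance.
Local Open Scope classical_set_scope.
Local Open Scope ereal_scope.
Context d (T : measurableType d) (R : realType) (P : probability T R).

Lemma Lfun2P (X : T -> R) : measurable_fun setT X ->
  (X \in Lfun P 2%:E) <-> \int[P]_x ((X x) ^+ 2)%:E < +oo.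
Proof.
move=> mX.
have -> : \int[P]_x ((X x) ^+ 2)%:E = 'N[P]_2%:E[EFin \o X] `^ 2.
  rewrite poweR_Lnorm//; apply: eq_integral => x _ /=.
  by rewrite powR_mulrn// real_normK// num_real.
split.
  by rewrite inE => /andP[_]; rewrite inE /finite_norm => /= /poweR_lty ->.
move=> h; rewrite inE; apply/andP; split; rewrite inE//=.
by rewrite /finite_norm; exact: (lty_poweRy _ h).
Qed.

Lemma varianceEint (X : T -> R) :
  'V_P[X] = \int[P]_x ((X x - fine 'E_P[X]) ^+ 2)%:E.
Proof. by rewrite /variance covariance.unlock expectation.unlock. Qed.

(** No integrability is assumed: when X is not square integrable both sides are
    infinite, whatever value is taken for its expectation. *)
Lemma integral_sqrB (X : T -> R) (a : R) : measurable_fun setT X ->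
  \int[P]_x ((X x - a) ^+ 2)%:E = 'V_P[X] + ((fine 'E_P[X] - a) ^+ 2)%:E.
Proof.
move=> mX.
have [X2|X2] := boolP (X \in Lfun P 2%:E).
  have Xa2 : (X \- cst a)%R \in Lfun P 2%:E.
    rewrite -[(X \- cst a)%R]/(X - cst a)%R.
    by rewrite rpredB ?lee1n//= => *; rewrite ?Lfun_cst.
  rewrite -(varianceB_cst_r a X2) varianceE//.
  have X1 : X \in Lfun P 1 by rewrite Lfun_subset12// fin_num_measure.
  rewrite expectationB// ?Lfun_cst// expectation_cst.
  have fE : 'E_P[X] \is a fin_num by exact: expectation_fin_num.
  rewrite -(fineK fE) -EFinB/= -expr2 -addeA -EFinD addNr adde0.
  by rewrite expectation.unlock.
have hoo b : \int[P]_x ((X x - b) ^+ 2)%:E = +oo.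
  apply/eqP; rewrite -leye_eq leNgt; apply/negP => h.
  move/negP: X2; apply.
  rewrite (_ : X = (X \- cst b) + cst b)%R; last first.
    by apply/funext => x /=; rewrite fctE subrK.
  have Xb2 : (X \- cst b)%R \in Lfun P 2%:E.
    by apply: (Lfun2P _).2 => //; apply: measurable_funB.
  by rewrite rpredD ?lee1n//= => *; rewrite ?Lfun_cst.
by rewrite varianceEint !hoo.
Qed.

Lemma measurable_sqr (X : T -> R) (a : R) : measurable_fun setT X ->
  measurable_fun setT (fun x => ((X x - a) ^+ 2)%:E).
Proof.
move=> mX; apply/measurable_EFinP.
by apply: measurable_funX; apply: measurable_funB.
Qed.

(** The variance as half the mean square difference of two independent copies,
    a form without centering, to which Fatou's lemma applies. *)
Lemma variance_double (X : T -> R) : measurable_fun setT X ->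
  \int[P]_y \int[P]_x ((X x - X y) ^+ 2)%:E = 'V_P[X] + 'V_P[X].
Proof.
move=> mX.
under eq_integral => y _.
  rewrite integral_sqrB// -[X in ((X ^+ 2)%:E)]opprB sqrrN.
  over.
rewrite ge0_integralD//=.
- by rewrite integral_cst// [X in _ * X + _](_ : _ = 1) ?mule1 -?varianceEint//; exact: probability_setT.
- by move=> x _; exact: variance_ge0.
- by move=> x _; rewrite lee_fin sqr_ge0.
- exact: measurable_sqr.
Qed.

(** Fatou's lemma for the mean square difference of two independent copies. Only
    the differences have to converge, so that each term of the sequence may be
    shifted by a constant of its own. *)
Lemma variance_lsc (X : T -> R) (Xk : nat -> T -> R) (B : \bar R) :
  measurable_fun setT X -> (forall k, measurable_fun setT (Xk k)) ->
  (forall x y, (Xk ^~ x \- Xk ^~ y)%R @ \oo --> (X x - X y)%R) ->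
  (forall k, 'V_P[Xk k] <= B) -> 'V_P[X] <= B.
Proof.
move=> mX mXk cX VB.
have mprod (Z : T -> R) : measurable_fun setT Z ->
    measurable_fun setT (fun z : T * T => ((Z z.2 - Z z.1) ^+ 2)%:E).
  move=> mZ; apply/measurable_EFinP; apply: measurable_funX.
  by apply: measurable_funB; apply: measurableT_comp.
have prodV (Z : T -> R) : measurable_fun setT Z ->
    \int[(P \x P)%E]_z ((Z z.2 - Z z.1) ^+ 2)%:E = 'V_P[Z] + 'V_P[Z].
  move=> mZ; rewrite -variance_double//.
  rewrite (fubini_tonelli1 (fun z : T * T => ((Z z.2 - Z z.1) ^+ 2)%:E))//.
    exact: mprod.
  by move=> z; rewrite lee_fin sqr_ge0.
suff : 'V_P[X] + 'V_P[X] <= B + B.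
  have B0 : 0 <= B by exact: le_trans (variance_ge0 P (Xk 0%N)) (VB 0%N).
  have := variance_ge0 P X.
  case: ('V_P[X]) => [v||]//; case: B B0 {VB} => [b||]//.
  - by rewrite !lee_fin => *; lra.
  - by move=> *; rewrite leey.
rewrite -prodV//.
have -> : \int[(P \x P)%E]_z ((X z.2 - X z.1) ^+ 2)%:E =
    \int[(P \x P)%E]_z limn_einf (fun k => ((Xk k z.2 - Xk k z.1) ^+ 2)%:E).
  apply: eq_integral => -[x y] _ /=; apply/esym.
  have h : (fun k => ((Xk k y - Xk k x) ^+ 2)%:E) @ \oo --> ((X y - X x) ^+ 2)%:E.
    apply: cvg_EFin; first by near=> k.
    rewrite [X in X @ _ --> _](_ : _ = fun k => (Xk k y - Xk k x) ^+ 2)%R//.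
    by under eq_fun do rewrite expr2; rewrite expr2; apply: cvgM; exact: cX.
  by rewrite is_cvg_limn_einfE; [exact/cvg_lim|apply/cvg_ex; eexists; exact: h].
apply: le_trans (fatou _ _ _ _) _ => //.
- by move=> k; exact: mprod.
- by move=> k z _; rewrite lee_fin sqr_ge0.
rewrite limn_einf_lim.
apply: lime_le; first exact: is_cvg_einfs.
apply: nearW => k.
apply: (@le_trans _ _ (\int[(P \x P)%E]_z ((Xk k z.2 - Xk k z.1) ^+ 2)%:E)).
  by apply: ereal_inf_lbound; exists k => /=.
by rewrite prodV// leeD.
Unshelve. all: by end_near. Qed.

End variance.

(** * Bounded functions on product spaces *)

Section bounded_functions.
Local Open Scope classical_set_scope.
Local Open Scope ereal_scope.
Context (R : realType).

(** Nonnegative values keep every integral within the reach of Tonelli's theorem;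
    the upper bound keeps the integrals finite. *)
Definition bounded_mfun d (T : measurableType d) (M : R) (f : T -> R) :=
  measurable_fun setT f /\ forall x, (0 <= f x <= M)%R.

Section one.
Context d (T : measurableType d) (P : probability T R) (M : R).
Variable f : T -> R.
Hypothesis bf : bounded_mfun M f.

Lemma bounded_mfun_integrable : P.-integrable setT (EFin \o f).
Proof.
case: bf => mf fM; apply/integrableP; split; first exact/measurable_EFinP.
apply: (@le_lt_trans _ _ (\int[P]_x (cst M%:E x))).
  apply: ge0_le_integral => //=.
  - exact/measurable_EFinP/measurableT_comp.
  - by move=> x _; case/andP: (fM x) => f0 f1; rewrite lee_fin ger0_norm.
by rewrite integral_cst// [X in _ * X](_ : _ = 1) ?mule1 ?ltry//; exact: probability_setT.
Qed.

Lemma EFin_Rintegral : (\int[P]_x f x)%:E = \int[P]_x (f x)%:E.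
Proof. by rewrite fineK//; exact: integrable_fin_num bounded_mfun_integrable. Qed.

Lemma Rintegral_bounds : (0 <= (\int[P]_x f x)%R <= M)%R.
Proof.
case: bf => mf fM; rewrite -!lee_fin EFin_Rintegral; apply/andP; split.
  by apply: integral_ge0 => x _; rewrite lee_fin; case/andP: (fM x).
apply: (@le_trans _ _ (\int[P]_x (cst M%:E x))).
  apply: ge0_le_integral => //=.
  - by move=> x _; rewrite lee_fin; case/andP: (fM x).
  - exact/measurable_EFinP.
  - by move=> x _; rewrite lee_fin; case/andP: (fM x).
by rewrite integral_cst// [X in _ * X](_ : _ = 1) ?mule1//; exact: probability_setT.
Qed.

Lemma fine_expectation : (fine 'E_P[f] = \int[P]_x f x)%R.
Proof. by rewrite expectation.unlock. Qed.

Lemma integral_sqr :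
  \int[P]_x ((f x) ^+ 2)%:E = 'V_P[f] + (((\int[P]_x f x)%R) ^+ 2)%:E.
Proof.
have := integral_sqrB P 0%R bf.1; rewrite subr0 fine_expectation => <-.
by apply: eq_integral => x _; rewrite subr0.
Qed.

Lemma bounded_mfun_sqr : bounded_mfun (M ^+ 2)%R (fun x => f x ^+ 2)%R.
Proof.
case: bf => mf fM; split; first exact: measurable_funX.
by move=> x; case/andP: (fM x) => f0 f1; rewrite sqr_ge0 lerXn2r// nnegrE// (le_trans f0).
Qed.

End one.

Section two.
Context d1 d2 (T1 : measurableType d1) (T2 : measurableType d2).
Context (P1 : probability T1 R) (P2 : probability T2 R) (M : R).
Variable k : T1 * T2 -> R.
Hypothesis bk : bounded_mfun M k.

Lemma bounded_mfun_pair1 x : bounded_mfun M (fun y => k (x, y)).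
Proof.
by case: bk => mk kM; split => //; apply: measurableT_comp.
Qed.

Lemma bounded_mfun_pair2 y : bounded_mfun M (fun x => k (x, y)).
Proof.
by case: bk => mk kM; split => //; apply: measurableT_comp.
Qed.

Lemma bounded_mfun_Rintegral2 : bounded_mfun M (fun x => (\int[P2]_y k (x, y))%R).
Proof.
split; last by move=> x; exact: Rintegral_bounds (bounded_mfun_pair1 x).
apply/measurable_EFinP.
rewrite [X in measurable_fun _ X](_ : _ = fubini_F P2 (EFin \o k)).
  apply: measurable_fun_fubini_tonelli_F => [|z].
    by apply/measurable_EFinP; exact: bk.1.
  by rewrite lee_fin; case/andP: (bk.2 z).
by apply/funext => x; rewrite /= (EFin_Rintegral _ (bounded_mfun_pair1 _)).
Qed.

Lemma bounded_mfun_Rintegral1 : bounded_mfun M (fun y => (\int[P1]_x k (x, y))%R).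
Proof.
split; last by move=> x; exact: Rintegral_bounds (bounded_mfun_pair2 x).
apply/measurable_EFinP.
rewrite [X in measurable_fun _ X](_ : _ = fubini_G P1 (EFin \o k)).
  apply: measurable_fun_fubini_tonelli_G => [|z].
    by apply/measurable_EFinP; exact: bk.1.
  by rewrite lee_fin; case/andP: (bk.2 z).
by apply/funext => x; rewrite /= (EFin_Rintegral _ (bounded_mfun_pair2 _)).
Qed.

Lemma Rintegral_swap :
  (\int[P1]_x \int[P2]_y k (x, y) = \int[P2]_y \int[P1]_x k (x, y))%R.
Proof.
apply: EFin_inj.
rewrite (EFin_Rintegral _ bounded_mfun_Rintegral2).
rewrite (EFin_Rintegral _ bounded_mfun_Rintegral1).
under eq_integral do rewrite (EFin_Rintegral _ (bounded_mfun_pair1 _)).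
under [RHS]eq_integral do rewrite (EFin_Rintegral _ (bounded_mfun_pair2 _)).
apply: (fubini_tonelli (EFin \o k)) => [|z /=].
  by apply/measurable_EFinP; exact: bk.1.
by rewrite lee_fin; case/andP: (bk.2 z).
Qed.

Lemma measurable_centered_sqr :
  measurable_fun setT (fun z => ((k z - (\int[P2]_y k (z.1, y))%R) ^+ 2)%:E).
Proof.
apply/measurable_EFinP/measurable_funX/measurable_funB; first exact: bk.1.
exact: (measurableT_comp bounded_mfun_Rintegral2.1).
Qed.

Lemma measurable_variance :
  measurable_fun setT (fun x => 'V_P2[fun y => k (x, y)]).
Proof.
rewrite [X in measurable_fun _ X](_ : _ = fubini_F P2
    (fun z => ((k z - (\int[P2]_y k (z.1, y))%R) ^+ 2)%:E)).
  apply: measurable_fun_fubini_tonelli_F => [|z].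
    exact: measurable_centered_sqr.
  by rewrite lee_fin sqr_ge0.
by apply/funext => x; rewrite varianceEint fine_expectation.
Qed.

(** Convexity of the variance. With p x the mean of k (x, .), the deviation of
    the averaged function from its mean is the average over x of k (x, y) - p x;
    its square is at most the average of the squares, and the integral over y of
    (k (x, y) - p x)^2 is the variance of k (x, .). *)
Lemma variance_Rintegral_le :
  'V_P2[fun y => (\int[P1]_x k (x, y))%R] <= \int[P1]_x 'V_P2[fun y => k (x, y)].
Proof.
under eq_integral do rewrite varianceEint fine_expectation.
rewrite varianceEint fine_expectation -Rintegral_swap.
rewrite (fubini_tonelli (fun z => ((k z - (\int[P2]_y k (z.1, y))%R) ^+ 2)%:E)).
- apply: ge0_le_integral => //.
  + by move=> y _; rewrite lee_fin sqr_ge0.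
  + exact: measurable_sqr bounded_mfun_Rintegral1.1.
  + apply: (measurable_fun_fubini_tonelli_G
      (fun z => ((k z - (\int[P2]_y k (z.1, y))%R) ^+ 2)%:E)).
      exact: measurable_centered_sqr.
    by move=> z; rewrite lee_fin sqr_ge0.
  + move=> y _ /=.
    rewrite -RintegralB//; last 2 first.
      exact: bounded_mfun_integrable (bounded_mfun_pair2 y).
      exact: bounded_mfun_integrable bounded_mfun_Rintegral2.
    set g := (fun x => k (x, y) - \int[P2]_y k (x, y))%R.
    have mg : measurable_fun setT g.
      by apply: measurable_funB;
       [exact: (bounded_mfun_pair2 y).1|exact: bounded_mfun_Rintegral2.1].
    rewrite [leRHS](_ : _ = \int[P1]_x ((g x - 0) ^+ 2)%:E); last first.
      by apply: eq_integral => x _; rewrite subr0.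
    rewrite integral_sqrB// subr0 fine_expectation leeDr//.
    exact: variance_ge0.
- exact: measurable_centered_sqr.
- by move=> z; rewrite lee_fin sqr_ge0.
Qed.

End two.

End bounded_functions.

(** * Supermodular set functions and covers *)

Section supermodular.
Local Open Scope ring_scope.
Context (R : realDomainType) (n : nat).

Lemma min_degree_le (C : {set {set 'I_n}}) (i : 'I_n) :
  (min_degree C <= #|[set S in C | i \in S]%SET|)%N.
Proof.
rewrite /min_degree; have : i \in index_enum 'I_n by rewrite mem_index_enum.
elim: (index_enum _) => // j r IH; rewrite big_cons in_cons => /predU1P[->|/IH].
  exact: geq_minl.
by apply: leq_trans; exact: geq_minr.
Qed.

Let prefix k := [set i : 'I_n | (i < k)%N]%SET.

Lemma prefixS (i : 'I_n) : prefix i.+1 = (i |: prefix i)%SET.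
Proof. by apply/setP => j; rewrite !inE ltnS leq_eqVlt. Qed.

Lemma prefixn : prefix n = [set: 'I_n]%SET.
Proof. by apply/setP => j; rewrite !inE ltn_ord. Qed.

Lemma prefix0 : prefix 0 = finset.set0.
Proof. by apply/setP => j; rewrite !inE. Qed.

(** Shearer's argument. Along the chain of initial segments, a increases from
    a set0 to a setT by steps D i. Along the chain of the unions of ~: S with the
    initial segments, supermodularity makes the step at i in S at least D i, and
    the other steps vanish. Summing over C counts each D i at least min_degree C
    times. *)
Lemma supermodular_cover (a : {set 'I_n} -> R) (C : {set {set 'I_n}}) :
  (forall X Y : {set 'I_n}, X \subset Y -> a X <= a Y) ->
  (forall X Y : {set 'I_n}, a X + a Y <= a (X :|: Y)%SET + a (X :&: Y)%SET) ->
  (min_degree C)%:R * (a [set: 'I_n]%SET - a finset.set0) <=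
    \sum_(S in C) (a [set: 'I_n]%SET - a (~: S)%SET).
Proof.
move=> mono super.
pose D (i : 'I_n) := a (prefix i.+1) - a (prefix i).
have D0 i : 0 <= D i by rewrite subr_ge0 mono// prefixS finset.subsetUr.
have aD : a [set: 'I_n]%SET - a finset.set0 = \sum_(i < n) D i.
  rewrite -(big_mkord xpredT (fun i => a (prefix i.+1) - a (prefix i))).
  by rewrite telescope_sumr// prefixn prefix0.
have Sge (S : {set 'I_n}) :
    \sum_(i in S) D i <= a [set: 'I_n]%SET - a (~: S)%SET.
  pose b k := a (~: S :|: prefix k)%SET.
  have -> : a [set: 'I_n]%SET - a (~: S)%SET = \sum_(i < n) (b i.+1 - b i).
    rewrite -(big_mkord xpredT (fun i => b i.+1 - b i)) telescope_sumr//.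
    by rewrite /b prefixn prefix0 finset.setUT finset.setU0.
  rewrite big_mkcond/=; apply: ler_sum => i _; rewrite /b prefixS.
  case: ifPn => iS; last first.
    by rewrite subr_ge0 mono// finset.setUS// finset.subsetUr.
  rewrite /D prefixS lerBlDr addrAC lerBrDr.
  rewrite [leLHS]addrC (le_trans (super _ _))// lerD ?mono//.
    by apply/fintype.subsetP => j; rewrite !inE => /orP[/orP[]|] ->; rewrite ?orbT.
  apply/fintype.subsetP => j; rewrite !inE => /andP[/orP[jS|//]].
  by case/predU1P => // ji; rewrite ji iS in jS.
rewrite (le_trans _ (ler_sum _ (fun S _ => Sge S)))//.
rewrite aD mulr_sumr (exchange_big_dep xpredT)//=; apply: ler_sum => i _.
rewrite sumr_const -[leRHS]mulr_natl ler_wpM2r// ler_nat.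
by rewrite (leq_trans (min_degree_le _ i))// eq_leq// cardsE; apply: eq_card => S.
Qed.

End supermodular.

(** * The Euclidean norm and the slope of a function *)

Section euclidean_norm.
Local Open Scope ring_scope.
Context (R : realType) (d : nat).
Implicit Types x y : 'rV[R]_d.

Lemma enorm_ge0 x : 0 <= enorm x.
Proof. exact: sqrtr_ge0. Qed.

Lemma sqr_enorm x : enorm x ^+ 2 = \sum_(j < d) x ord0 j ^+ 2.
Proof. by rewrite sqr_sqrtr// sumr_ge0// => j _; rewrite sqr_ge0. Qed.

Lemma enorm_eq0 x : enorm x = 0 -> x = 0.
Proof.
move=> x0; have := sqr_enorm x; rewrite x0 expr0n/= => /esym/psumr_eq0P h.
apply/rowP => j; rewrite mxE; apply/eqP; rewrite -sqrf_eq0; apply/eqP/h => //.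
by move=> i _; rewrite sqr_ge0.
Qed.

Lemma enorm_gt0 x : x != 0 -> 0 < enorm x.
Proof.
by move=> x0; rewrite lt_def enorm_ge0 andbT; apply: contra_neq x0 => /enorm_eq0.
Qed.

Lemma enormZ a x : enorm (a *: x) = `|a| * enorm x.
Proof.
rewrite /enorm; under eq_bigr do rewrite mxE exprMn.
by rewrite -mulr_sumr sqrtrM ?sqr_ge0// sqrtr_sqr.
Qed.

Lemma enormN x : enorm (- x) = enorm x.
Proof. by rewrite -scaleN1r enormZ normrN1 mul1r. Qed.

Lemma normr_le_enorm x : `|x| <= enorm x.
Proof.
rewrite /Num.norm/= mx_normrE; apply: bigmax_le => [|[i j] _ /=].
  exact: enorm_ge0.
rewrite -[leLHS]sqrtr_sqr ler_wsqrtr// ord1 (bigD1 j)//= lerDl sumr_ge0//.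
by move=> *; rewrite sqr_ge0.
Qed.

Lemma enorm_le_normr x : enorm x <= Num.sqrt d%:R * `|x|.
Proof.
have -> : Num.sqrt d%:R * `|x| = Num.sqrt (d%:R * `|x| ^+ 2).
  by rewrite sqrtrM ?ler0n// sqrtr_sqr normr_id.
apply: ler_wsqrtr.
have -> : d%:R * `|x| ^+ 2 = \sum_(j < d) `|x| ^+ 2.
  by rewrite sumr_const card_ord mulr_natl.
apply: ler_sum => j _; rewrite -[leLHS]real_normK ?num_real//.
rewrite lerXn2r ?nnegrE//.
by rewrite [leRHS]/Num.norm/= mx_normrE (le_trans _ (le_bigmax _ _ (ord0, j))).
Qed.

Lemma cauchy_schwarz x y :
  `|\sum_(j < d) x ord0 j * y ord0 j| <= enorm x * enorm y.
Proof.
have [->|y0] := eqVneq y 0.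
  rewrite big1 ?normr0 ?mulr_ge0 ?enorm_ge0// => j _.
  by rewrite mxE mulr0.
have ey := enorm_gt0 y0.
set s := \sum_(j < d) _.
rewrite -(ler_pXn2r (ltn0Sn 1)) ?nnegrE ?mulr_ge0 ?enorm_ge0//.
rewrite real_normK ?num_real// exprMn.
(* The square norm of |y|^2 x - (x.y) y is nonnegative. *)
have : 0 <= \sum_(j < d) (enorm y ^+ 2 * x ord0 j - s * y ord0 j) ^+ 2.
  by rewrite sumr_ge0// => *; rewrite sqr_ge0.
have -> : \sum_(j < d) (enorm y ^+ 2 * x ord0 j - s * y ord0 j) ^+ 2 =
    enorm y ^+ 2 * (enorm x ^+ 2 * enorm y ^+ 2 - s ^+ 2).
  transitivity (\sum_(j < d) (enorm y ^+ 4 * (x ord0 j ^+ 2)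
      - (2 * enorm y ^+ 2 * s) * (x ord0 j * y ord0 j)
      + s ^+ 2 * y ord0 j ^+ 2)).
    by apply: eq_bigr => j _; ring.
  rewrite big_split/= sumrB -!mulr_sumr -!sqr_enorm -/s; ring.
by rewrite pmulr_rge0 ?exprn_gt0// subr_ge0.
Qed.

End euclidean_norm.

Section slope.
Local Open Scope classical_set_scope.
Local Open Scope ring_scope.
Context (R : realType) (d : nat).
Implicit Types (f g : 'rV[R]_d -> R) (x y h : 'rV[R]_d).

(** The pointwise Lipschitz constant of f at x. *)
Definition slope f x : \bar R :=
  limf_esup (fun y => (`|f x - f y| / enorm (x - y))%:E) x^'.

(** The quotients are indexed by increments h = y - x, which makes the
    invariance under translations and the dependence on x for a fixed h
    apparent. *)
Let quot f x h : \bar R := (`|f x - f (x + h)| / enorm h)%:E.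

Let slope_at f (e : R) x : \bar R :=
  ereal_sup (quot f x @` [set h | h != 0 /\ `|h| < e]).

Lemma slope_le f x e : 0 < e -> (slope f x <= slope_at f e x)%E.
Proof.
move=> e0; rewrite /slope limf_esupE; apply: ereal_inf_lbound.
exists [set y | y != x /\ `|y - x| < e].
  rewrite /dnbhs /within/=; apply: (@filterS _ (nbhs x) _ [set y | `|y - x| < e]).
    by move=> y ye yx; split.
  apply/nbhs_ballP; exists e => //= y.
  by rewrite mx_norm_ball/= distrC.
congr (ereal_sup _); apply/seteqP; split => _ [y /= [y0 ye] <-].
  exists (y - x); first by rewrite subr_eq0.
  by rewrite /quot [x + _]addrC subrK -(enormN (y - x)) opprB.
exists (x + y); last by rewrite /quot opprD addrA subrr sub0r enormN.
by rewrite addrAC subrr add0r -subr_eq0 addrAC subrr add0r.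
Qed.

Lemma slope_ge f x (z : \bar R) :
  (forall e, 0 < e -> (z <= slope_at f e x)%E) -> (z <= slope f x)%E.
Proof.
move=> zf; rewrite /slope limf_esupE; apply: le_ereal_inf_tmp => _ [V Vx <-].
move: Vx; rewrite /dnbhs /within/= => /nbhs_ballP[e /= e0 xV].
apply: (le_trans (zf _ e0)); apply: ge_ereal_sup => _ [h /= [h0 he] <-].
apply: ereal_sup_ubound; exists (x + h); last first.
  by rewrite /quot opprD addrA subrr sub0r enormN.
apply: xV; last by rewrite -subr_eq0 addrAC subrr add0r.
by rewrite mx_norm_ball/= opprD addrA subrr sub0r normrN.
Qed.

Lemma slope_shift f y x : slope (fun z => f (z + y)) x = slope f (x + y).
Proof.
have H e : slope_at (fun z => f (z + y)) e x = slope_at f e (x + y).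
  by congr (ereal_sup _); apply: eq_imagel => h _; rewrite /quot addrAC.
by apply/eqP; rewrite eq_le; apply/andP; split; apply: slope_ge => e e0;
  [rewrite -H|rewrite H]; exact: slope_le.
Qed.

Lemma slope_contract f g : (forall x y, `|g x - g y| <= `|f x - f y|) ->
  forall x, (slope g x <= slope f x)%E.
Proof.
move=> gf x; apply: slope_ge => e e0; apply: (le_trans (slope_le _ _ e0)).
apply: ge_ereal_sup => _ [h he <-].
apply: (@le_trans _ _ (quot f x h)); last by apply: ereal_sup_ubound; exists h.
by rewrite lee_fin ler_wpM2r// invr_ge0 enorm_ge0.
Qed.

Lemma slope_ge0 f x : (0 < d)%N -> (0 <= slope f x)%E.
Proof.
move=> d0; apply: slope_ge => e e0.
pose h : 'rV[R]_d := const_mx (e / 2).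
have e20 : 0 < e / 2 by rewrite divr_gt0.
apply: (@le_trans _ _ (quot f x h)).
  by rewrite lee_fin divr_ge0// enorm_ge0.
apply: ereal_sup_ubound; exists h => //=; split.
  apply/eqP => /rowP/(_ (Ordinal d0)); rewrite !mxE => /eqP.
  by rewrite gt_eqF.
rewrite /Num.norm/= mx_normrE; apply: bigmax_lt => // -[i j] _ /=.
by rewrite mxE gtr0_norm// ltr_pdivrMr// ltr_pMr// ltr1n.
Qed.

Lemma measurable_continuous f : continuous f ->
  measurable_fun [set: borelRd R d] f.
Proof.
move=> cf; apply: (measurability _ (RGenOInfty.measurableE R)) => _ [_ [a ->] <-].
rewrite setTI; apply: sub_sigma_algebra => /=.
by apply: open_comp; [move=> x _; exact: cf|exact: interval_open].
Qed.

Lemma measurable_slope_at f e : continuous f ->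
  measurable_fun [set: borelRd R d] (slope_at f e).
Proof.
move=> cf; apply: (measurability _ (ErealGenOInfty.measurableE R)).
move=> _ [_ [a ->] <-]; rewrite setTI; apply: sub_sigma_algebra => /=.
rewrite (_ : _ @^-1` _ = \bigcup_(h in [set h | h != 0 /\ `|h| < e])
    ((fun x => `|f x - f (x + h)| / enorm h) @^-1` `]a, +oo[)).
  apply: bigcup_open => h _; apply: open_comp; last exact: interval_open.
  move=> x _; apply: (@cvgM R _ (nbhs x)); last exact: cvg_cst.
  apply: cvg_norm; apply: cvgB; first exact: cf.
  apply: (@cvg_comp _ _ _ (fun z => z + h) f _ (nbhs (x + h))); last exact: cf.
  by apply: cvgD; [exact: cvg_id|exact: cvg_cst].
apply/seteqP; split => x /=.
  rewrite in_itv/= andbT => /ereal_sup_gt[_ [h he <-]] ah.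
  by exists h => //=; rewrite in_itv/= andbT -lte_fin.
move=> [h he]; rewrite /= !in_itv/= !andbT => ah.
rewrite (@lt_le_trans _ _ (quot f x h))//.
by apply: ereal_sup_ubound; exists h.
Qed.

(** The upper limit is an infimum, over radii 1 / k, of suprema of continuous
    functions, and such suprema are lower semicontinuous. *)
Lemma measurable_slope f : continuous f ->
  measurable_fun [set: borelRd R d] (slope f).
Proof.
move=> cf.
rewrite (_ : slope f = fun x => einfs (fun k => slope_at f k.+1%:R^-1 x) 0).
  by apply: measurable_fun_einfs => k; exact: measurable_slope_at.
apply/funext => x; apply/eqP; rewrite eq_le; apply/andP; split.
  apply: le_ereal_inf_tmp => _ [k _ <-]; apply: slope_le.
  by rewrite invr_gt0.
apply: slope_ge => e e0.
have [k ke] : exists k, k.+1%:R^-1 < e.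
  have [k _ /(_ k (leqnn k))] := near_infty_natSinv_lt (PosNum e0).
  by exists k.
apply: (@le_trans _ _ (slope_at f k.+1%:R^-1 x)).
  by apply: ereal_inf_lbound; exists k.
apply: ereal_sup_le => _ [h [h0 hk] <-]; exists h => //; split => //.
exact: lt_trans ke.
Qed.

Lemma diff_gradient f x h : differentiable f x ->
  'd f x h = \sum_(j < d) h ord0 j * gradient f x ord0 j.
Proof.
move=> df; rewrite {1}(row_sum_delta h) linear_sum; apply: eq_bigr => j _.
by rewrite linearZ/= mxE deriveE.
Qed.

Lemma differentiable_expansion f x e : differentiable f x -> 0 < e ->
  exists2 r : R, 0 < r & forall h, `|h| < r ->
    `|f (x + h) - f x - \sum_(j < d) h ord0 j * gradient f x ord0 j|
      <= e * enorm h.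
Proof.
move=> df e0; have /eqaddoP/(_ _ e0) := diff_locally df.
move=> /nbhs_ballP[r /= r0 hr]; exists r => // h hh.
apply: le_trans (_ : _ <= e * `|h|) _; last first.
  by apply: ler_wpM2l; [exact: ltW|exact: normr_le_enorm].
rewrite -diff_gradient//.
have := hr h; rewrite mx_norm_ball/= sub0r normrN => /(_ hh).
by rewrite fctE/= [x + h]addrC opprD addrA.
Qed.

(** At a point of differentiability the difference quotient along h is, up to a
    small error, the absolute value of the scalar product of the gradient with
    the unit vector of h: at most the norm of the gradient by Cauchy-Schwarz,
    with equality along the gradient. In dimension 0 punctured neighborhoods are
    empty and the upper limit is -oo, whence the hypothesis on d. *)
Lemma norm_gradientE f : (0 < d)%N -> norm_gradient f = slope f.
Proof.
move=> d0; apply/funext => x; rewrite /norm_gradient.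
case: asboolP => // df; set G := gradient f x.
apply/eqP; rewrite eq_le; apply/andP; split; last first.
  apply/lee_addgt0Pr => e e0.
  have [r r0 hr] := differentiable_expansion df e0.
  apply: (le_trans (slope_le f x r0)); apply: ge_ereal_sup => _ [h /= [h0 hlt] <-].
  rewrite lee_fin ler_pdivrMr ?enorm_gt0//.
  have := hr _ hlt; have := cauchy_schwarz h G; rewrite -/G !ler_norml.
  by move=> /andP[? ?] /andP[? ?]; apply/andP; split; lra.
have [G0|G0] := eqVneq (enorm G) 0; first by rewrite G0 slope_ge0.
have {}G0 : 0 < enorm G by rewrite lt_def G0 enorm_ge0.
apply/lee_addgt0Pr => e e0; rewrite -leeBlDr//.
apply: slope_ge => s s0.
have [r r0 hr] := differentiable_expansion df e0.
(* The increment is a small positive multiple of the gradient. *)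
pose t := Num.min r s / (2 * enorm G).
have t0 : 0 < t by rewrite divr_gt0 ?mulr_gt0 ?lt_min ?r0.
have eh : enorm (t *: G) = t * enorm G by rewrite enormZ gtr0_norm.
have hlt : `|t *: G| < Num.min r s.
  rewrite (le_lt_trans (normr_le_enorm _))// eh /t invfM mulrA mulfVK ?gt_eqF//.
  by rewrite ltr_pdivrMr// ltr_pMr ?ltr1n// lt_min r0.
move: hlt; rewrite lt_min => /andP[hltr hlts].
apply: (@le_trans _ _ (quot f x (t *: G))); last first.
  apply: ereal_sup_ubound; exists (t *: G) => //=; split => //.
  apply: contraPneq G0 => /(congr1 (@enorm R d)).
  rewrite eh [X in _ = X](_ : _ = 0).
    by move=> /eqP; rewrite mulf_eq0 gt_eqF//= => /eqP ->; rewrite ltxx.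
  by rewrite -(scale0r 0) enormZ normr0 mul0r.
rewrite -EFinB lee_fin ler_pdivlMr; last by rewrite eh mulr_gt0.
have := hr _ hltr; rewrite -/G.
have -> : \sum_(j < d) (t *: G) ord0 j * G ord0 j = t * enorm G ^+ 2.
  by rewrite sqr_enorm mulr_sumr; apply: eq_bigr => j _; rewrite mxE expr2 mulrA.
rewrite eh ler_norml ler_normr => /andP[? ?].
by apply/orP; right; lra.
Qed.


End slope.

(** * Locally Lipschitz functions *)

Section locally_lipschitz.
Local Open Scope classical_set_scope.
Local Open Scope ring_scope.
Context (R : realType) (d : nat).
Implicit Types (f g : 'rV[R]_d -> R) (x y h : 'rV[R]_d).

Lemma locally_lipschitz_continuous f : locally_lipschitz f -> continuous f.
Proof.
move=> lf x; have [L] := lf x => -[[A B] [/= xA xB] AB].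
apply: (proj2 (@cvgrPdist_le _ _ _ (nbhs x) _ f (f x))) => e e0.
pose K := `|L| * Num.sqrt d%:R + 1.
have K0 : 0 < K by rewrite ltr_wpDl// mulr_ge0// sqrtr_ge0.
near=> y.
have Ay : A y by near: y.
have Bx : B x by exact: nbhs_singleton.
rewrite distrC (le_trans (AB (y, x) _))//=.
apply: (@le_trans _ _ (`|L| * (Num.sqrt d%:R * `|y - x|))).
  apply: (@le_trans _ _ (`|L| * enorm (y - x))).
    by rewrite ler_wpM2r ?enorm_ge0// ler_norm.
  by rewrite ler_wpM2l// enorm_le_normr.
rewrite mulrA (@le_trans _ _ (K * `|y - x|))//.
  by rewrite ler_wpM2r// /K lerDl.
rewrite -ler_pdivlMl// distrC ltW//.
near: y; apply/nbhs_ballP; exists (K^-1 * e) => /=; first by rewrite mulr_gt0// invr_gt0.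
by move=> y; rewrite mx_norm_ball.
Unshelve. all: by end_near. Qed.

Lemma locally_lipschitz_shift f h :
  locally_lipschitz f -> locally_lipschitz (fun x => f (x + h)).
Proof.
move=> lf x; have [L] := lf (x + h) => -[[A B] [/= xA xB] AB].
have cs : continuous (fun y : 'rV[R]_d => y + h).
  by move=> y; apply: (@cvgD _ _ _ (nbhs y) _ id (cst h)); [exact: cvg_id|exact: cvg_cst].
exists L.
exists ((fun y => y + h) @^-1` A, (fun y => y + h) @^-1` B) => /=.
  by split; exact: cs.
move=> [y z] /= [Ay Bz]; have := AB (y + h, z + h) (conj Ay Bz).
by rewrite /= opprD addrACA subrr addr0.
Qed.

Lemma locally_lipschitz_contract f g :
  (forall x y, `|g x - g y| <= `|f x - f y|) ->
  locally_lipschitz f -> locally_lipschitz g.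
Proof.
move=> gf lf x; have [L] := lf x => -[AB xAB sAB].
exists L; exists AB => // yz /sAB.
exact: le_trans.
Qed.

End locally_lipschitz.

(** * Integrals against convolutions *)

Section convolution.
Local Open Scope classical_set_scope.
Local Open Scope ereal_scope.
Context (R : realType) (d : nat).
Local Notation rV := ('rV[R]_d).
Local Notation prob := (probability (borelRd R d) R).
Implicit Types (mu nu : prob) (x y : rV).

Section translations.
Context d' (T : measurableType d').
Implicit Type g : rV -> T.

Lemma measurable_add g : measurable_fun [set: borelRd R d] g ->
  measurable_fun [set: borelRd R d * borelRd R d]
    (fun z : rV * rV => g (z.1 + z.2)%R).
Proof. by move=> mg; apply: (measurableT_comp mg); exact: measurable_addRd. Qed.

Lemma measurable_shiftr g y : measurable_fun [set: borelRd R d] g ->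
  measurable_fun [set: borelRd R d] (fun x : rV => g (x + y)%R).
Proof.
move=> /measurable_add mg.
exact: (measurableT_comp mg (@pair2_measurable _ _ _ _ (y : borelRd R d))).
Qed.

Lemma measurable_shiftl g y : measurable_fun [set: borelRd R d] g ->
  measurable_fun [set: borelRd R d] (fun x : rV => g (y + x)%R).
Proof.
move=> /(measurable_shiftr y); congr measurable_fun.
by apply/funext => x; rewrite addrC.
Qed.

End translations.

Implicit Type g : rV -> \bar R.

Lemma measurable_integral_shift g nu : measurable_fun [set: borelRd R d] g ->
  (forall x, 0 <= g x) ->
  measurable_fun [set: borelRd R d] (fun x : rV => \int[nu]_y g (x + y)%R).
Proof.
move=> mg g0.
by apply: (measurable_fun_fubini_tonelli_F
  (fun z : borelRd R d * borelRd R d => g ((z.1 : rV) + (z.2 : rV))%R)) => //;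
  exact: measurable_add.
Qed.

Lemma integral_convolution mu nu g : measurable_fun [set: borelRd R d] g ->
  (forall x, 0 <= g x) ->
  \int[convolution mu nu]_x g x = \int[mu]_x \int[nu]_y g (x + y)%R.
Proof.
move=> mg g0; rewrite ge0_integral_distribution//.
rewrite (fubini_tonelli1 (g \o @addRd R d))//; first exact: (measurable_add mg).
by move=> z; exact: g0.
Qed.

Lemma integral_swap mu nu g : measurable_fun [set: borelRd R d] g ->
  (forall x, 0 <= g x) ->
  \int[mu]_x \int[nu]_y g (x + y)%R = \int[nu]_y \int[mu]_x g (x + y)%R.
Proof.
move=> mg g0.
by apply: (fubini_tonelli
  (fun z : borelRd R d * borelRd R d => g ((z.1 : rV) + (z.2 : rV))%R)) => //;
  exact: measurable_add.
Qed.

Lemma integral_delta0 g : measurable_fun [set: borelRd R d] g ->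
  \int[delta0 R d]_x g x = g 0%R.
Proof. by move=> mg; rewrite integral_dirac// diracT mul1e. Qed.

(** Convolution is associative and commutative only as far as integrals of
    measurable functions are concerned, since measures are functions on all sets
    and may differ on nonmeasurable ones. The law of a union is therefore
    described by the integrals against it, by induction on the index list, with
    Tonelli's theorem to move the law of an index of Q past those of P. *)
Lemma integral_big_convolution (I : Type) (r : seq I) (P Q : pred I)
    (mu : I -> prob) g : (forall i, ~~ (P i && Q i)) ->
  measurable_fun [set: borelRd R d] g -> (forall x, 0 <= g x) ->
  \int[\big[@convolution R d / delta0 R d]_(i <- r | P i || Q i) mu i]_x g x =
  \int[\big[@convolution R d / delta0 R d]_(i <- r | P i) mu i]_x
  \int[\big[@convolution R d / delta0 R d]_(i <- r | Q i) mu i]_y g (x + y)%R.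
Proof.
move=> PQ; elim: r g => [|i r IH] g mg g0.
  rewrite !big_nil integral_delta0// integral_delta0//.
    by rewrite integral_delta0 ?addr0//; exact: measurable_shiftl.
  exact: measurable_integral_shift.
pose p := \big[@convolution R d / delta0 R d]_(j <- r | P j) mu j.
pose q := \big[@convolution R d / delta0 R d]_(j <- r | Q j) mu j.
have IHu u : \int[\big[@convolution R d / delta0 R d]_(i <- r | P i || Q i) mu i]_x
     g (u + x)%R = \int[p]_x \int[q]_y g (u + (x + y))%R.
  by apply: IH => //; exact: measurable_shiftl.
have mq := measurable_integral_shift q mg g0.
have q0 x : 0 <= \int[q]_y g (x + y)%R by exact: integral_ge0.
have := PQ i; case eP: (P i); case eQ: (Q i); first by move=> /notF.
- move=> _; rewrite !big_cons eP eQ [LHS](integral_convolution _ _ mg g0).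
  rewrite [RHS](integral_convolution _ _ mq q0).
  apply: eq_integral => u _; rewrite IHu.
  by apply: eq_integral => x _; apply: eq_integral => y _; rewrite addrA.
- move=> _; rewrite !big_cons eP eQ [LHS](integral_convolution _ _ mg g0).
  transitivity (\int[mu i]_u \int[p]_x \int[q]_y g (u + x + y)%R).
    apply: eq_integral => u _; rewrite IHu.
    by apply: eq_integral => x _; apply: eq_integral => y _; rewrite addrA.
  rewrite (integral_swap (mu i) p mq q0).
  apply: eq_integral => x _.
  rewrite (integral_convolution (mu i) q (measurable_shiftl x mg) (fun y => g0 (x + y)%R)).
  apply: eq_integral => u _; apply: eq_integral => y _.
  by rewrite addrA [(u + x)%R]addrC.
- by move=> _; rewrite !big_cons eP eQ; exact: IH.
Qed.

Lemma integral_convolution_setU n (mu : 'I_n -> prob) (X Y : {set 'I_n}) g :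
  [disjoint X & Y]%B ->
  measurable_fun [set: borelRd R d] g -> (forall x, 0 <= g x) ->
  \int[convolution_set mu (X :|: Y)%SET]_x g x =
  \int[convolution_set mu X]_x \int[convolution_set mu Y]_y g (x + y)%R.
Proof.
move=> XY mg g0; rewrite /convolution_set -integral_big_convolution//.
  by under eq_bigl do rewrite inE.
move=> i; apply/andP => -[iX iY].
by have := disjointFr XY iX; rewrite iY.
Qed.

Lemma convolution_set0 n (mu : 'I_n -> prob) :
  convolution_set mu finset.set0 = delta0 R d.
Proof. by rewrite /convolution_set big_pred0// => i; rewrite inE. Qed.

End convolution.

(** * Variance of a function of a sum *)

Section two_variables.
Local Open Scope classical_set_scope.
Local Open Scope ring_scope.
Context (R : realType) d1 d2 (T1 : measurableType d1) (T2 : measurableType d2).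
Context (P1 : probability T1 R) (P2 : probability T2 R) (M : R).
Variable k : T1 * T2 -> R.
Hypothesis bk : bounded_mfun M k.

(** [variance_Rintegral_le] with the variances written as differences of second
    moments: supermodularity of the energy for two independent variables. *)
Lemma Rintegral_sqr_supermodular :
  \int[P1]_x (\int[P2]_y k (x, y)) ^+ 2 + \int[P2]_y (\int[P1]_x k (x, y)) ^+ 2
  <= \int[P1]_x \int[P2]_y k (x, y) ^+ 2 + (\int[P1]_x \int[P2]_y k (x, y)) ^+ 2.
Proof.
rewrite -lee_fin !EFinD.
have b1 := bounded_mfun_Rintegral1 P1 bk.
have b2 := bounded_mfun_Rintegral2 P2 bk.
rewrite (EFin_Rintegral _ (bounded_mfun_sqr b1)).
rewrite (EFin_Rintegral _ (bounded_mfun_sqr b2)).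
rewrite (integral_sqr _ b1) -(Rintegral_swap P1 P2 bk) addeA.
rewrite leeD2r// (EFin_Rintegral _ (bounded_mfun_Rintegral2 P2 (bounded_mfun_sqr bk))).
rewrite [leRHS](_ : _ = \int[P1]_x ('V_P2[fun y => k (x, y)] +
    ((\int[P2]_y k (x, y))%R ^+ 2)%:E))%E; last first.
  apply: eq_integral => x _.
  rewrite (EFin_Rintegral _ (bounded_mfun_pair1 (bounded_mfun_sqr bk) x)).
  exact: integral_sqr (bounded_mfun_pair1 bk x).
rewrite ge0_integralD//.
- by rewrite [leLHS]addeC leeD2r//; exact: variance_Rintegral_le bk.
- by move=> x _; exact: variance_ge0.
- exact: measurable_variance bk.
- by move=> x _; rewrite lee_fin sqr_ge0.
- by apply/measurable_EFinP; exact: (bounded_mfun_sqr b2).1.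
Qed.

End two_variables.

Section variance_of_sums.
Local Open Scope classical_set_scope.
Local Open Scope ring_scope.
Context (R : realType) (n d : nat) (mu : 'I_n -> probability (borelRd R d) R).
Local Notation rV := ('rV[R]_d).
Local Notation law := (convolution_set mu).
Implicit Types (S X Y : {set 'I_n}) (f : borelRd R d -> R) (M : R).

Definition average S f : borelRd R d -> R :=
  fun x => \int[law S]_y f ((x : rV) + (y : rV)).

Lemma bounded_mfun_add M f : bounded_mfun M f ->
  bounded_mfun M (fun z : borelRd R d * borelRd R d => f ((z.1 : rV) + (z.2 : rV))).
Proof. by move=> [mf fM]; split => //; exact: measurable_add. Qed.

Lemma bounded_mfun_shift M f (x : rV) : bounded_mfun M f ->
  bounded_mfun M (fun y : borelRd R d => f (x + (y : rV))).
Proof. by move=> /bounded_mfun_add /bounded_mfun_pair1; exact. Qed.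

Lemma bounded_mfun_average M S f :
  bounded_mfun M f -> bounded_mfun M (average S f).
Proof. by move=> /bounded_mfun_add /bounded_mfun_Rintegral2; exact. Qed.

Lemma Rintegral_setU M X Y f : [disjoint X & Y]%B -> bounded_mfun M f ->
  \int[law (X :|: Y)%SET]_x f x =
  \int[law X]_x \int[law Y]_y f ((x : rV) + (y : rV)).
Proof.
move=> XY bf; apply: EFin_inj; rewrite (EFin_Rintegral _ bf).
rewrite (@integral_convolution_setU _ _ _ mu _ _ (EFin \o f) XY); last 2 first.
- by apply/measurable_EFinP; exact: bf.1.
- by move=> x; rewrite lee_fin; case/andP: (bf.2 x).
rewrite (EFin_Rintegral _ (bounded_mfun_average Y bf)).
by apply: eq_integral => x _; rewrite (EFin_Rintegral _ (bounded_mfun_shift x bf)).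
Qed.

Lemma averageU M X Y f : [disjoint X & Y]%B -> bounded_mfun M f ->
  average (X :|: Y)%SET f = average X (average Y f).
Proof.
move=> XY bf; apply/funext => x.
rewrite /average (Rintegral_setU XY (bounded_mfun_shift x bf)).
by apply: eq_Rintegral => u _; apply: eq_Rintegral => v _; rewrite addrA.
Qed.

Lemma average0 M f : bounded_mfun M f -> average finset.set0 f = f.
Proof.
move=> bf; apply/funext => x; apply: EFin_inj.
rewrite (EFin_Rintegral _ (bounded_mfun_shift x bf)) convolution_set0.
rewrite integral_delta0 ?addr0//.
by apply/measurable_EFinP; exact: (bounded_mfun_shift x bf).1.
Qed.

(** The second moment of the conditional expectation of f (sum of the X_i) given
    the variables indexed by S. *)
Definition energy f S : R := \int[law S]_x (average (~: S)%SET f x) ^+ 2.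

(** Jensen's inequality for the average over the variables of Y :\: X. *)
Lemma energy_mono M f X Y : bounded_mfun M f -> X \subset Y ->
  energy f X <= energy f Y.
Proof.
move=> bf XY.
have dXY : [disjoint X & Y :\: X]%B.
  by rewrite -setI_eq0; apply/eqP/setP => i; rewrite !inE; case: (i \in X).
have dXY' : [disjoint Y :\: X & ~: Y]%B.
  by rewrite -setI_eq0; apply/eqP/setP => i; rewrite !inE; case: (i \in Y); rewrite ?andbF.
have EY : Y = (X :|: (Y :\: X))%SET.
  apply/setP => i; rewrite !inE; have := fintype.subsetP XY i.
  by case: (i \in X) => //= ->.
have EX : (~: X = (Y :\: X) :|: ~: Y)%SET.
  apply/setP => i; rewrite !inE; have := fintype.subsetP XY i.
  by case: (i \in X) => [->|]//=; case: (i \in Y).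
have bh := bounded_mfun_average (~: Y)%SET bf.
set h := average (~: Y)%SET f in bh.
have bg := bounded_mfun_average (Y :\: X)%SET bh.
rewrite /energy EX (averageU dXY' bf) -/h.
have := Rintegral_setU dXY (bounded_mfun_sqr bh); rewrite -EY => ->.
apply: le_Rintegral => //.
- exact: bounded_mfun_integrable (bounded_mfun_sqr bg).
- exact: bounded_mfun_integrable (bounded_mfun_average _ (bounded_mfun_sqr bh)).
- move=> x _; rewrite -lee_fin.
  have bx := bounded_mfun_shift x bh.
  rewrite (EFin_Rintegral _ (bounded_mfun_sqr bx)) (integral_sqr _ bx).
  by rewrite leeDr// variance_ge0.
Qed.

(** The indices split into T = X :&: Y, A = X :\: Y, B = Y :\: X and the rest W.
    Once W is averaged out and the variables of T are fixed, the claim is the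
    inequality for the two independent sums over A and B. *)
Lemma energy_supermodular M f X Y : bounded_mfun M f ->
  energy f X + energy f Y <= energy f (X :|: Y)%SET + energy f (X :&: Y)%SET.
Proof.
move=> bf.
pose T := (X :&: Y)%SET; pose A := (X :\: Y)%SET; pose B := (Y :\: X)%SET.
pose W := (~: (X :|: Y))%SET.
have dis (U V : {set 'I_n}) : (forall i, ~~ ((i \in U) && (i \in V))) -> [disjoint U & V]%B.
  move=> h; rewrite -setI_eq0; apply/eqP/setP => i; rewrite !inE.
  exact/negbTE.
have TA : [disjoint T & A]%B.
  by apply: dis => i; rewrite !inE; case: (i \in X); case: (i \in Y).
have TB : [disjoint T & B]%B.
  by apply: dis => i; rewrite !inE; case: (i \in X); case: (i \in Y).
have AB : [disjoint A & B]%B.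
  by apply: dis => i; rewrite !inE; case: (i \in X); case: (i \in Y).
have TAB : [disjoint T & (A :|: B)%SET]%B.
  by apply: dis => i; rewrite !inE; case: (i \in X); case: (i \in Y).
have AW : [disjoint A & W]%B.
  by apply: dis => i; rewrite !inE; case: (i \in X); case: (i \in Y).
have BW : [disjoint B & W]%B.
  by apply: dis => i; rewrite !inE; case: (i \in X); case: (i \in Y).
have ABW : [disjoint A & (B :|: W)%SET]%B.
  by apply: dis => i; rewrite !inE; case: (i \in X); case: (i \in Y).
have EX : X = (T :|: A)%SET.
  by apply/setP => i; rewrite !inE; case: (i \in X); case: (i \in Y).
have EY : Y = (T :|: B)%SET.
  by apply/setP => i; rewrite !inE; case: (i \in X); case: (i \in Y).
have EXY : (X :|: Y = T :|: (A :|: B))%SET.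
  by apply/setP => i; rewrite !inE; case: (i \in X); case: (i \in Y).
have CX : (~: X = B :|: W)%SET.
  by apply/setP => i; rewrite !inE; case: (i \in X); case: (i \in Y).
have CY : (~: Y = A :|: W)%SET.
  by apply/setP => i; rewrite !inE; case: (i \in X); case: (i \in Y).
have CT : (~: T = A :|: (B :|: W))%SET.
  by apply/setP => i; rewrite !inE; case: (i \in X); case: (i \in Y).
have bh := bounded_mfun_average W bf; set h := average W f in bh.
have bA := bounded_mfun_average A bh.
have bB := bounded_mfun_average B bh.
have bAB := bounded_mfun_average A bB.
have eX : energy f X = \int[law T]_x average A (fun u => average B h u ^+ 2) x.
  rewrite /energy CX (averageU BW bf) EX.
  exact: Rintegral_setU TA (bounded_mfun_sqr bB).
have eY : energy f Y = \int[law T]_x average B (fun u => average A h u ^+ 2) x.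
  rewrite /energy CY (averageU AW bf) EY.
  exact: Rintegral_setU TB (bounded_mfun_sqr bA).
have eT : energy f T = \int[law T]_x (average A (average B h) x) ^+ 2.
  by rewrite /energy CT (averageU ABW bf) (averageU BW bf).
have eXY : energy f (X :|: Y)%SET =
    \int[law T]_x average A (average B (fun u => h u ^+ 2)) x.
  rewrite -(averageU AB (bounded_mfun_sqr bh)) /energy -/W -/h EXY.
  exact: Rintegral_setU TAB (bounded_mfun_sqr bh).
have iA := bounded_mfun_integrable (law T) (bounded_mfun_average A (bounded_mfun_sqr bB)).
have iB := bounded_mfun_integrable (law T) (bounded_mfun_average B (bounded_mfun_sqr bA)).
have iT := bounded_mfun_integrable (law T) (bounded_mfun_sqr bAB).
have iXY := bounded_mfun_integrable (law T)
  (bounded_mfun_average A (bounded_mfun_average B (bounded_mfun_sqr bh))).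
rewrite -/T eX eY eT eXY.
rewrite -(RintegralD measurableT iA iB) -(RintegralD measurableT iXY iT).
apply: le_Rintegral.
- exact: measurableT.
- by apply: (@integrableD _ _ _ _ _ _ (EFin \o _) (EFin \o _)).
- by apply: (@integrableD _ _ _ _ _ _ (EFin \o _) (EFin \o _)).
move=> x _.
have bk := bounded_mfun_add (bounded_mfun_shift x bh).
have := Rintegral_sqr_supermodular (law A) (law B) bk.
have eAB u : \int[law B]_v h (x + (u + v)) = average B h (x + u).
  by apply: eq_Rintegral => v _; rewrite addrA.
have eBA v : \int[law A]_u h (x + (u + v)) = average A h (x + v).
  by apply: eq_Rintegral => u _; rewrite addrA addrAC.
have -> : \int[law A]_u (\int[law B]_v h (x + (u + v))) ^+ 2 =
    average A (fun u => average B h u ^+ 2) x.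
  by apply: eq_Rintegral => u _; rewrite eAB.
have -> : \int[law B]_v (\int[law A]_u h (x + (u + v))) ^+ 2 =
    average B (fun u => average A h u ^+ 2) x.
  by apply: eq_Rintegral => v _; rewrite eBA.
have -> : \int[law A]_u \int[law B]_v h (x + (u + v)) ^+ 2 =
    average A (average B (fun u => h u ^+ 2)) x.
  apply: eq_Rintegral => u _; apply: eq_Rintegral => v _.
  by rewrite addrA.
have -> : \int[law A]_u \int[law B]_v h (x + (u + v)) = average A (average B h) x.
  by apply: eq_Rintegral => u _; rewrite eAB.
by [].
Qed.

(** Second moment = variance + square of the mean, applied to f (x + .) under
    law S and integrated over x ~ law (~: S). *)
Lemma integral_variance M f S : bounded_mfun M f ->
  (\int[law (~: S)%SET]_x 'V_(law S)[fun y => f ((x : rV) + (y : rV))%R] =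
   (energy f [set: 'I_n]%SET - energy f (~: S)%SET)%:E)%E.
Proof.
move=> bf.
have bs := bounded_mfun_average S bf.
have dS : [disjoint ~: S & S]%B.
  by rewrite -setI_eq0; apply/eqP/setP => i; rewrite !inE; case: (i \in S).
have : (energy f [set: 'I_n]%SET)%:E =
    (\int[law (~: S)%SET]_x 'V_(law S)[fun y => f ((x : rV) + (y : rV))%R] +
     (energy f (~: S)%SET)%:E)%E.
  rewrite /energy finset.setCT (average0 bf) finset.setCK.
  rewrite -(finset.setUCr S) finset.setUC (Rintegral_setU dS (bounded_mfun_sqr bf)).
  rewrite (EFin_Rintegral _ (bounded_mfun_average _ (bounded_mfun_sqr bf))).
  rewrite (EFin_Rintegral _ (bounded_mfun_sqr bs)) -ge0_integralD//.
  - apply: eq_integral => x _; have bx := bounded_mfun_shift x bf.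
    by rewrite (EFin_Rintegral _ (bounded_mfun_sqr bx)) (integral_sqr _ bx).
  - by move=> x _; exact: variance_ge0.
  - exact: measurable_variance (bounded_mfun_add bf).
  - by move=> x _; rewrite lee_fin sqr_ge0.
  - by apply/measurable_EFinP; exact: (bounded_mfun_sqr bs).1.
by rewrite EFinB => ->; rewrite addeK.
Qed.

(** A generalized Efron-Stein inequality, the classical one being the case where
    C consists of the singletons. *)
Lemma variance_cover M f (C : {set {set 'I_n}}) : bounded_mfun M f ->
  ((min_degree C)%:R%:E * 'V_(law [set: 'I_n]%SET)[f] <=
   \sum_(S in C)
     \int[law (~: S)%SET]_x 'V_(law S)[fun y => f ((x : rV) + (y : rV))%R])%E.
Proof.
move=> bf; under eq_bigr do rewrite (integral_variance _ bf).
have -> : 'V_(law [set: 'I_n]%SET)[f] =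
    (energy f [set: 'I_n]%SET - energy f finset.set0)%:E.
  rewrite -[in energy _ finset.set0]finset.setCT -(integral_variance _ bf).
  rewrite finset.setCT convolution_set0 integral_delta0.
    by congr variance; apply/funext => y; rewrite add0r.
  exact: measurable_variance (bounded_mfun_add bf).
rewrite -EFinM sumEFin lee_fin; apply: supermodular_cover => X Y.
  exact: energy_mono bf.
exact: energy_supermodular bf.
Qed.

End variance_of_sums.

(** * Truncation and Poincare inequalities *)

Section truncation.
Local Open Scope classical_set_scope.
Local Open Scope ring_scope.
Context (R : realType) (T : Type).
Implicit Types (f : T -> R) (k : nat).

(** f cut at -k and k, then shifted by k so as to be nonnegative. *)
Definition truncation f k (x : T) : R :=
  Num.max 0 (Num.min (f x + k%:R) (k%:R + k%:R)).

Lemma truncation_bounds f k x : 0 <= truncation f k x <= k%:R + k%:R.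
Proof.
rewrite /truncation le_max lexx/= ge_max addr_ge0// ge_min lexx orbT//.
Qed.

Lemma truncation_contract f k x y :
  `|truncation f k x - truncation f k y| <= `|f x - f y|.
Proof.
have min_contract (u v m : R) : `|Num.min u m - Num.min v m| <= `|u - v|.
  have := ler_norm (u - v); have := ler_norm (v - u); rewrite distrC => ? ?.
  by case: (leP u m) => ?; case: (leP v m) => ?;
    rewrite ler_norml; apply/andP; split; lra.
have max_contract (u v : R) : `|Num.max 0 u - Num.max 0 v| <= `|u - v|.
  have := ler_norm (u - v); have := ler_norm (v - u); rewrite distrC => ? ?.
  by case: (leP 0 u) => ?; case: (leP 0 v) => ?;
    rewrite ler_norml; apply/andP; split; lra.
rewrite (le_trans (max_contract _ _))// (le_trans (min_contract _ _ _))//.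
by rewrite opprD addrACA subrr addr0.
Qed.

Lemma truncation_cvg f x y :
  (fun k => truncation f k x - truncation f k y) @ \oo --> f x - f y.
Proof.
have H z k : `|f z| <= k%:R -> truncation f k z = f z + k%:R.
  rewrite ler_norml => /andP[? ?].
  rewrite /truncation min_l; last lra.
  by rewrite max_r//; lra.
apply: cvg_near_cst.
near=> k.
have kxy : `|f x| + `|f y| <= k%:R by near: k; exact: nbhs_infty_ger.
rewrite !H; first by rewrite opprD addrACA subrr addr0.
  by rewrite (le_trans _ kxy)// lerDr.
by rewrite (le_trans _ kxy)// lerDl.
Unshelve. all: by end_near. Qed.

End truncation.

Section poincare_cover.
Local Open Scope classical_set_scope.
Local Open Scope ring_scope.
Context (R : realType) (n d : nat) (mu : 'I_n -> probability (borelRd R d) R).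
Hypothesis d0 : (0 < d)%N.
Local Notation rV := ('rV[R]_d).
Local Notation law := (convolution_set mu).

Lemma measurable_slope_sqr (f : rV -> R) : locally_lipschitz f ->
  measurable_fun [set: borelRd R d] (fun x => slope f x ^+ 2)%E.
Proof.
move=> /locally_lipschitz_continuous /measurable_slope mf.
rewrite (_ : (fun x => _) = (fun x => slope f x * slope f x)%E).
  exact: emeasurable_funM.
by apply/funext => x; rewrite expe2.
Qed.

Lemma slope_sqr_ge0 (f : rV -> R) x : (0 <= slope f x ^+ 2)%E.
Proof. by rewrite expe2 mule_ge0// slope_ge0. Qed.

(** The Poincare inequality of law S for f (x + .), integrated over the law of
    the remaining variables; both sides are then integrals against law T. *)
Lemma poincare_cover_bounded (C : {set {set 'I_n}}) (c : {set 'I_n} -> R)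
    (M : R) (f : rV -> R) :
  (forall S, S \in C -> 0 <= c S /\ poincare (law S) (c S)) ->
  bounded_mfun M (f : borelRd R d -> R) -> locally_lipschitz f ->
  ((min_degree C)%:R%:E * 'V_(law [set: 'I_n]%SET)[f] <=
   (\sum_(S in C) c S)%:E * \int[law [set: 'I_n]%SET]_x (slope f x ^+ 2))%E.
Proof.
move=> cP bf lf; apply: (le_trans (variance_cover mu C bf)).
rewrite -sumEFin ge0_sume_distrl; last by move=> S /cP[? _]; rewrite lee_fin.
apply: lee_sum => S /cP[c0 pS].
have mg := measurable_slope_sqr lf.
have g0 := slope_sqr_ge0 f.
have dS : [disjoint ~: S & S]%B.
  by rewrite -setI_eq0; apply/eqP/setP => i; rewrite !inE; case: (i \in S).
rewrite -(finset.setUCr S) finset.setUC (integral_convolution_setU _ dS mg g0).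
have mI := measurable_integral_shift (law S) mg g0.
rewrite -ge0_integralZl_EFin//; last by move=> x _; exact: integral_ge0.
apply: ge0_le_integral => //.
- by move=> x _; exact: variance_ge0.
- exact: measurable_variance (bounded_mfun_add bf).
- exact: measurable_funeM.
- move=> x _.
  pose fx (y : rV) := f (y + (x : rV)).
  have -> : (fun y : borelRd R d => f ((x : rV) + (y : rV))) = fx.
    by apply/funext => y; rewrite /fx addrC.
  have := pS fx (locally_lipschitz_shift (x : rV) lf).
  rewrite (norm_gradientE fx d0).
  rewrite (_ : (fun y => slope fx y ^+ 2)%E = (fun y => slope f (x + y) ^+ 2)%E).
    by [].
  by apply/funext => y; rewrite slope_shift addrC.
Qed.

Lemma poincare_cover (C : {set {set 'I_n}}) (c : {set 'I_n} -> R) :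
  (0 < min_degree C)%N ->
  (forall S, S \in C -> 0 <= c S /\ poincare (law S) (c S)) ->
  poincare (law [set: 'I_n]%SET) ((min_degree C)%:R^-1 * \sum_(S in C) c S).
Proof.
move=> t0 cP f lf; rewrite norm_gradientE//.
have mf g : locally_lipschitz g -> measurable_fun [set: borelRd R d] g.
  by move=> /locally_lipschitz_continuous /measurable_continuous.
have lk k : locally_lipschitz (truncation f k).
  by apply: (locally_lipschitz_contract _ lf); exact: truncation_contract.
apply: (@variance_lsc _ (borelRd R d) R (law [set: 'I_n]%SET) f (truncation f)) => //.
- exact: mf.
- by move=> k; exact: mf.
- exact: truncation_cvg.
move=> k.
have bk : bounded_mfun (k%:R + k%:R) (truncation f k : borelRd R d -> R).
  by split; [exact: mf|move=> x; exact: truncation_bounds].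
have t0' : (0 < (min_degree C)%:R :> R) by rewrite ltr0n.
rewrite EFinM -muleA lee_pdivlMl//.
apply: (le_trans (poincare_cover_bounded cP bk (lk k))).
apply: lee_wpmul2l.
  by rewrite lee_fin sumr_ge0// => S /cP[].
apply: ge0_le_integral => //.
- by move=> x _; exact: slope_sqr_ge0.
- exact: measurable_slope_sqr.
- exact: measurable_slope_sqr.
- move=> x _; rewrite !expe2 lee_pmul ?slope_ge0// slope_contract//;
  exact: truncation_contract.
Qed.

End poincare_cover.

Section poincare_constant.
Local Open Scope classical_set_scope.
Local Open Scope ereal_scope.
Context (R : realType) (d : nat) (mu : probability (borelRd R d) R).

Lemma poincare_constant_ge0 : 0 <= poincare_constant mu.
Proof. by apply: le_ereal_inf_tmp => _ [c [c0 _] <-]; rewrite lee_fin. Qed.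

Lemma poincare_constant_le c : (0 <= c)%R -> poincare mu c ->
  poincare_constant mu <= c%:E.
Proof. by move=> c0 pc; apply: ereal_inf_lbound; exists c. Qed.

(** The infimum need not be attained: with c = 0 the right-hand side of the
    inequality vanishes even when the Dirichlet energy is infinite. *)
Lemma poincare_constant_approx e : (0 < e)%R -> poincare_constant mu < +oo ->
  exists c, [/\ (0 <= c)%R, poincare mu c & c%:E <= poincare_constant mu + e%:E].
Proof.
move=> e0 fin.
have /lb_ereal_inf_adherent : poincare_constant mu \is a fin_num.
  by rewrite ge0_fin_numE// poincare_constant_ge0.
by move=> /(_ _ e0)[_ [c [c0 pc] <-] /ltW ce]; exists c.
Qed.

End poincare_constant.

Local Open Scope ring_scope.

Theorem theorem1 (R : realType) (n d : nat) (hn : (0 < n)%N) (hd : (0 < d)%N)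
  (mu : 'I_n -> probability (borelRd R d) R) (C : {set {set 'I_n}})
  (ht : (1 <= min_degree C)%N) :
  (poincare_constant (convolution_set mu [set: 'I_n]%SET)
     <= ((min_degree C)%:R^-1)%:E
        * \sum_(S in C) poincare_constant (convolution_set mu S))%E.
Proof.
set K := fun S => poincare_constant (convolution_set mu S).
have K0 S : (0 <= K S)%E by exact: poincare_constant_ge0.
have t0 : 0 < (min_degree C)%:R :> R by rewrite ltr0n.
have [Kfin|] := pselect (forall S, S \in C -> (K S < +oo)%E); last first.
  move=> /existsNP[S /not_implyP[SC /negP]]; rewrite -leNgt leye_eq => /eqP KS.
  rewrite (bigD1 S)//= -/(K S) KS addye.
    by rewrite gt0_muley ?leey// lte_fin invr_gt0.
  by rewrite -ltNye (@lt_le_trans _ _ 0%E)// sume_ge0// => ? _; exact: K0.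
(* The constants of the members of C are approximated within e', whose total
   contribution is at most e. *)
apply/lee_addgt0Pr => e e0.
pose e' := e * (min_degree C)%:R / (#|C|.+1)%:R.
have e'0 : 0 < e' by rewrite divr_gt0 ?mulr_gt0.
have /choice[c cP] : forall S, exists c, S \in C ->
    [/\ 0 <= c, poincare (convolution_set mu S) c & (c%:E <= K S + e'%:E)%E].
  move=> S; have [SC|SC] := boolP (S \in C); last by exists 0.
  have [c cP] := poincare_constant_approx e'0 (Kfin _ SC).
  by exists c.
apply: (@le_trans _ _ ((min_degree C)%:R^-1 * \sum_(S in C) c S)%:E).
  apply: poincare_constant_le; last first.
    by apply: poincare_cover => // S /cP[].
  by rewrite mulr_ge0 ?invr_ge0// sumr_ge0// => S /cP[].
rewrite EFinM -[e](mulKf (lt0r_neq0 t0)) EFinM -ge0_muleDr; last 2 first.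
- by apply: sume_ge0 => S _; exact: K0.
- by rewrite lee_fin mulr_ge0 ?ltW.
rewrite lee_wpmul2l ?lee_fin ?invr_ge0//.
apply: (@le_trans _ _ (\sum_(S in C) (K S + e'%:E))%E).
  by rewrite -sumEFin; apply: lee_sum => S /cP[].
rewrite big_split/= leeD2l// sumEFin lee_fin sumr_const -[leLHS]mulr_natl /e'.
rewrite mulrCA -[leRHS]mulr1 [e * _]mulrC ler_wpM2l ?mulr_ge0 ?(ltW e0)//.
by rewrite ler_pdivrMr// mul1r ler_nat.
Qed.
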